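(* Suppose that: 1. $\mathbb U,\mathbb X,\mathbb X_N,\mathbb Z$ are convex closed polyhedra, each containing $0$; $Q,R,S,P$ are symmetric positive definite; and $E$ is invertible; 2. $\mathbb X_N=\mathbb X$; 3. $\mathbb X$ is control invariant. Then the algorithm described in the context is recursively feasible in the sense that $x_0\in\mathbb X$ implies $x_0^+\in\mathbb X$, where $x_0^+=Ax_0+(B\ \ C)\,\xi_0^{\overline m}$. Moreover, $\mathcal X=\mathbb X$, where $\mathcal X=\{x_0\mid J(x_0)<\infty\}$; that is, the MPC problem remains feasible.
   Context: Problem data. Let $N\ge 1$, $A,P,Q\in\mathbb R^{n_x\times n_x}$, $B\in\mathbb R^{n_x\times n_u}$, $C\in\mathbb R^{n_x\times n_z}$, $D\in\mathbb R^{n_z\times n_x}$, $E,S\in\mathbb R^{n_z\times n_z}$, $R\in\mathbb R^{n_u\times n_u}$, and $\mathbb X,\mathbb X_N\subseteq\mathbb R^{n_x}$, $\mathbb U\subseteq\mathbb R^{n_u}$, $\mathbb Z\subseteq\mathbb R^{n_z}$. Let $x_0\in\mathbb R^{n_x}$ be the measured state (a parameter). Put $\ell(x,u,z)=x^\top Qx+u^\top Ru+z^\top Sz$ and $\mathcal M(x)=x^\top Px$. MPC problem: $J(x_0)$ is the minimum ($+\infty$ if infeasible) of $\sum_{k=0}^{N-1}\ell(x_k,u_k,z_k)+\mathcal M(x_N)$ over $x_1,\dots,x_N$, $u_0,\dots,u_{N-1}$, $z_0,\dots,z_{N-1}$ subject to, for $k=0,\dots,N-1$, $x_{k+1}=Ax_k+Bu_k+Cz_k$,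 $0=Dx_k+Ez_k$, $x_k\in\mathbb X$, $u_k\in\mathbb U$, $z_k\in\mathbb Z$, and $x_N\in\mathbb X_N$. Control invariance: a set $X\subseteq\mathbb X$ is control invariant if for every $x\in X$ there exist $x^+\in X$, $u\in\mathbb U$, $z\in\mathbb Z$ with $x^+=Ax+Bu+Cz$ and $0=Dx+Ez$. Stacked form. Let $y_0=(u_0,z_0)$, $y_k=(x_k,u_k,z_k)$ for $1\le k\le N-1$, $y_N=x_N$, $y=(y_0,\dots,y_N)$. For $0\le k\le N-1$ let $\mathbb Y_k$ be the set of $y_k$ with $Ax_k+Bu_k+Cz_k\in\mathbb X$, $0=Dx_k+Ez_k$, $x_k\in\mathbb X$, $u_k\in\mathbb U$, $z_k\in\mathbb Z$ (for $k=0$, $x_0$ is the given measurement, so $\mathbb Y_0$ is a set of pairs $(u_0,z_0)$ depending on $x_0$); $\mathbb Y_N=\mathbb X_N$. Let $\Phi_0(y_0)=u_0^\top Ru_0+z_0^\top Sz_0$, $\Phi_k(y_k)=\ell(x_k,u_k,z_k)$ for $1\le k\le N-1$, $\Phi_N(y_N)=\mathcal M(x_N)$, and $F(y)=\sum_{k=0}^N\Phi_k(y_k)$. Let $G_k=\begin{pmatrix}I&0&0\\0&0&0\end{pmatrix}$ for $1\le k\le N-1$, $G_N=\begin{pmatrix}I\\0\end{pmatrix}$, $H_0=\begin{pmatrix}B&C\\0&E\end{pmatrix}$, $H_k=\begin{pmatrix}A&B&C\\ D&0&E\end{pmatrix}$ for $1\le k\le N-1$, $h_0=\begin{pmatrix}Ax_0\\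 Dx_0\end{pmatrix}$, $h_k=0$ for $1\le k\le N-1$. The dynamic and algebraic constraints read $G_{k+1}y_{k+1}=H_ky_k+h_k$ ($0\le k\le N-1$), with multipliers $\lambda_k\in\mathbb R^{n_x+n_z}$, $\lambda=(\lambda_0,\dots,\lambda_{N-1})$, and Lagrangian sign convention $F(y)+\sum_{k=0}^{N-1}\lambda_k^\top(G_{k+1}y_{k+1}-H_ky_k-h_k)$. The conjugate function is $$F^\star(\lambda)=\max_y\Big\{-F(y)-(H_0^\top\lambda_0)^\top y_0+\sum_{k=1}^{N-1}(G_k^\top\lambda_{k-1}-H_k^\top\lambda_k)^\top y_k+\lambda_{N-1}^\top G_Ny_N\Big\}.$$ Algorithm (with constant $\gamma>0$, fixed iteration number $\overline m\in\mathbb N$, and initial guesses $y^1,\lambda^1$), executed at each sampling time. Step 1: receive the measurement $x_0$; compute $f^1=F(y^1)+F^\star(\lambda^1)$; if $f^1\ge\gamma^2x_0^\top Qx_0$ (and $f^1\neq0$), multiply both $y^1$ and $\lambda^1$ by $\sqrt{\gamma^2x_0^\top Qx_0/f^1}$. Step 2: for $m=1,\dots,\overline m$ do: (a) compute $\xi^m=(\xi_0^m,\dots,\xi_N^m)$ by solving separately $\xi_0^m=\arg\min_{\xi\in\mathbb Y_0}\Phi_0(\xi)-(H_0^\top\lambda_0^m)^\top\xi+\Phi_0(\xi-y_0^m)$, $\xi_k^m=\arg\min_{\xi\in\mathbb Y_k}\Phi_k(\xi)+(G_k^\top\lambda_{k-1}^m-H_k^\top\lambda_k^m)^\top\xi+\Phi_k(\xi-y_k^m)$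 for $1\le k\le N-1$, $\xi_N^m=\arg\min_{\xi\in\mathbb Y_N}\Phi_N(\xi)+(G_N^\top\lambda_{N-1}^m)^\top\xi+\Phi_N(\xi-y_N^m)$; (b) let $y^{m+1}$ be the minimizer and $\delta^m$ the multipliers (same sign convention) of: minimize $\sum_{k=0}^N\Phi_k(y_k^{m+1}-2\xi_k^m+y_k^m)$ over $y^{m+1}$ subject to $G_{k+1}y_{k+1}^{m+1}=H_ky_k^{m+1}+h_k$ for $0\le k\le N-1$; set $\lambda^{m+1}=\lambda^m+\delta^m$. Step 3: apply to the process the input $u_0$, the $u$-component of $\xi_0^{\overline m}$; the next measurement is $x_0^+=Ax_0+(B\ \ C)\xi_0^{\overline m}$. Step 4: replace $(y^1,\lambda^1)$ by the shifted sequences $y^1=[y_1^{\overline m},\dots,y_N^{\overline m},0]$, $\lambda^1=[\lambda_1^{\overline m},\dots,\lambda_{N-1}^{\overline m},0]$ (blocks truncated to their $(u,z)$-part, respectively zero-padded, to have matching dimensions) and return to Step 1. *)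

(* Defs.v *)
(* MathComp / MathComp-Analysis; reals are an arbitrary [R : realType]. *)
From HB Require Import structures.
From mathcomp Require Import all_boot all_order all_algebra.
From mathcomp Require Import boolp classical_sets reals constructive_ereal ereal.

Set Implicit Arguments.
Unset Strict Implicit.
Unset Printing Implicit Defensive.

Import Order.TTheory GRing.Theory Num.Theory.
Local Open Scope classical_set_scope.
Local Open Scope ring_scope.

Definition dotv (R : realType) (n : nat) (a b : 'cV[R]_n) : R :=
  (a^T *m b) 0 0.

Definition qform (R : realType) (n : nat) (M : 'M[R]_n) (v : 'cV[R]_n) : R :=
  (v^T *m M *m v) 0 0.

Definition sym_posdef (R : realType) (n : nat) (M : 'M[R]_n) : Prop :=
  M^T = M /\ forall v : 'cV[R]_n, v != 0 -> 0 < qform M v.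

(* A finite intersection of closed half-spaces: convexity and closedness are
   built in. *)
Definition is_polyhedron (R : realType) (n : nat) (S : set 'cV[R]_n) : Prop :=
  exists (m : nat) (M : 'M[R]_(m, n)) (b : 'cV[R]_m),
    S = [set v | forall i, (M *m v) i 0 <= b i 0].

Definition is_argmin (R : realType) (T : Type) (S : set T) (f : T -> R)
    (t : T) : Prop :=
  S t /\ forall s, S s -> f t <= f s.

Record mpc_data (R : realType) (nx nu nz : nat) := MpcData {
  dynA : 'M[R]_nx;
  dynB : 'M[R]_(nx, nu);
  dynC : 'M[R]_(nx, nz);
  algD : 'M[R]_(nz, nx);
  algE : 'M[R]_nz;
  costQ : 'M[R]_nx;
  costR : 'M[R]_nu;
  costS : 'M[R]_nz;
  costP : 'M[R]_nx;
  cstrX : set 'cV[R]_nx;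
  cstrU : set 'cV[R]_nu;
  cstrZ : set 'cV[R]_nz;
  cstrXN : set 'cV[R]_nx
}.

Definition next_state (R : realType) (nx nu nz : nat)
    (p : mpc_data R nx nu nz) (x : 'cV[R]_nx) (u : 'cV[R]_nu) (z : 'cV[R]_nz) :
    'cV[R]_nx :=
  dynA p *m x + dynB p *m u + dynC p *m z.

Definition alg_constraint (R : realType) (nx nu nz : nat)
    (p : mpc_data R nx nu nz) (x : 'cV[R]_nx) (z : 'cV[R]_nz) : Prop :=
  0 = algD p *m x + algE p *m z.

Definition stage_cost (R : realType) (nx nu nz : nat)
    (p : mpc_data R nx nu nz) (x : 'cV[R]_nx) (u : 'cV[R]_nu) (z : 'cV[R]_nz) :
    R :=
  qform (costQ p) x + qform (costR p) u + qform (costS p) z.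

Definition terminal_cost (R : realType) (nx nu nz : nat)
    (p : mpc_data R nx nu nz) (x : 'cV[R]_nx) : R :=
  qform (costP p) x.

(* Sequences are indexed by [nat]; only [x 0 .. x N] and [u, z] at indices
   below [N] are ever read. *)
Definition mpc_feasible (R : realType) (nx nu nz : nat)
    (p : mpc_data R nx nu nz) (N : nat) (x0 : 'cV[R]_nx)
    (x : nat -> 'cV[R]_nx) (u : nat -> 'cV[R]_nu) (z : nat -> 'cV[R]_nz) :
    Prop :=
  [/\ x 0%N = x0,
      forall k, (k < N)%N ->
        [/\ x k.+1 = next_state p (x k) (u k) (z k),
            alg_constraint p (x k) (z k),
            cstrX p (x k), cstrU p (u k) & cstrZ p (z k)]
    & cstrXN p (x N)].

Definition mpc_cost (R : realType) (nx nu nz : nat)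
    (p : mpc_data R nx nu nz) (N : nat)
    (x : nat -> 'cV[R]_nx) (u : nat -> 'cV[R]_nu) (z : nat -> 'cV[R]_nz) : R :=
  \sum_(k < N) stage_cost p (x k) (u k) (z k) + terminal_cost p (x N).

(* The infimum over the empty set is [+oo]. *)
Definition mpc_value (R : realType) (nx nu nz : nat)
    (p : mpc_data R nx nu nz) (N : nat) (x0 : 'cV[R]_nx) : \bar R :=
  ereal_inf [set c | exists x u z,
    mpc_feasible p N x0 x u z /\ c = (mpc_cost p N x u z)%:E].

Definition control_invariant (R : realType) (nx nu nz : nat)
    (p : mpc_data R nx nu nz) (Y : set 'cV[R]_nx) : Prop :=
  Y `<=` cstrX p /\
  forall x, Y x -> exists x' u z,
    [/\ Y x', cstrU p u, cstrZ p z, x' = next_state p x u z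
      & alg_constraint p x z].

(* From here on the horizon is [N = n.+1].  A stacked vector is the triple of
   [y_0 = (u_0, z_0)], the family [i |-> y_(i+1) = (x, u, z)] for [i < n]
   (that is, [y_1 .. y_(N-1)]), and [y_N = x_N]. *)
Notation stacked R nx nu nz n :=
  ('cV[R]_(nu + nz) * {ffun 'I_n -> 'cV[R]_(nx + (nu + nz))} * 'cV[R]_nx)%type.

(* [lambda_0 .. lambda_(N-1)] *)
Notation multipliers R nx nz n := {ffun 'I_n.+1 -> 'cV[R]_(nx + nz)}.

Definition xpart (R : realType) (nx nu nz : nat)
    (w : 'cV[R]_(nx + (nu + nz))) : 'cV[R]_nx := usubmx w.
Definition upart (R : realType) (nx nu nz : nat)
    (w : 'cV[R]_(nx + (nu + nz))) : 'cV[R]_nu := usubmx (dsubmx w).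
Definition zpart (R : realType) (nx nu nz : nat)
    (w : 'cV[R]_(nx + (nu + nz))) : 'cV[R]_nz := dsubmx (dsubmx w).

Definition stage_set (R : realType) (nx nu nz : nat)
    (p : mpc_data R nx nu nz) (x : 'cV[R]_nx) (u : 'cV[R]_nu) (z : 'cV[R]_nz) :
    Prop :=
  [/\ cstrX p (next_state p x u z), alg_constraint p x z,
      cstrX p x, cstrU p u & cstrZ p z].

Definition cstrY0 (R : realType) (nx nu nz : nat) (p : mpc_data R nx nu nz)
    (x0 : 'cV[R]_nx) : set 'cV[R]_(nu + nz) :=
  [set w | stage_set p x0 (usubmx w) (dsubmx w)].

Definition cstrY (R : realType) (nx nu nz : nat) (p : mpc_data R nx nu nz) :
    set 'cV[R]_(nx + (nu + nz)) :=
  [set w | stage_set p (xpart w) (upart w) (zpart w)].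

Definition cstrYN (R : realType) (nx nu nz : nat) (p : mpc_data R nx nu nz) :
    set 'cV[R]_nx := cstrXN p.

Definition Phi0 (R : realType) (nx nu nz : nat) (p : mpc_data R nx nu nz)
    (w : 'cV[R]_(nu + nz)) : R :=
  qform (costR p) (usubmx w) + qform (costS p) (dsubmx w).

Definition Phi (R : realType) (nx nu nz : nat) (p : mpc_data R nx nu nz)
    (w : 'cV[R]_(nx + (nu + nz))) : R :=
  stage_cost p (xpart w) (upart w) (zpart w).

Definition PhiN (R : realType) (nx nu nz : nat) (p : mpc_data R nx nu nz)
    (w : 'cV[R]_nx) : R :=
  terminal_cost p w.

Definition Fcost (R : realType) (nx nu nz n : nat) (p : mpc_data R nx nu nz)
    (y : stacked R nx nu nz n) : R :=
  Phi0 p y.1.1 + \sum_i Phi p (y.1.2 i) + PhiN p y.2.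

Definition Gmat (R : realType) (nx nu nz : nat) :
    'M[R]_(nx + nz, nx + (nu + nz)) :=
  block_mx 1%:M 0 0 0.

Definition GNmat (R : realType) (nx nz : nat) : 'M[R]_(nx + nz, nx) :=
  col_mx 1%:M 0.

Definition H0mat (R : realType) (nx nu nz : nat) (p : mpc_data R nx nu nz) :
    'M[R]_(nx + nz, nu + nz) :=
  block_mx (dynB p) (dynC p) 0 (algE p).

Definition Hmat (R : realType) (nx nu nz : nat) (p : mpc_data R nx nu nz) :
    'M[R]_(nx + nz, nx + (nu + nz)) :=
  block_mx (dynA p) (row_mx (dynB p) (dynC p)) (algD p) (row_mx 0 (algE p)).

Definition h0vec (R : realType) (nx nu nz : nat) (p : mpc_data R nx nu nz)
    (x0 : 'cV[R]_nx) : 'cV[R]_(nx + nz) :=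
  col_mx (dynA p *m x0) (algD p *m x0).

(* [G_(k+1) y_(k+1)]: the block [y_(k+1)] is [y.1.2 k] if [k < n] and [y_N] if
   [k = n]. *)
Definition Gside (R : realType) (nx nu nz n : nat)
    (y : stacked R nx nu nz n) (k : 'I_n.+1) : 'cV[R]_(nx + nz) :=
  if unlift ord_max k is Some i then Gmat R nx nu nz *m y.1.2 i
  else GNmat R nx nz *m y.2.

(* [H_k y_k + h_k]: for [k = j + 1] the block [y_k] is [y.1.2 j], and
   [h_k = 0]. *)
Definition Hside (R : realType) (nx nu nz n : nat) (p : mpc_data R nx nu nz)
    (x0 : 'cV[R]_nx) (y : stacked R nx nu nz n) (k : 'I_n.+1) :
    'cV[R]_(nx + nz) :=
  if unlift ord0 k is Some j then Hmat p *m y.1.2 j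
  else H0mat p *m y.1.1 + h0vec p x0.

Definition coupled (R : realType) (nx nu nz n : nat) (p : mpc_data R nx nu nz)
    (x0 : 'cV[R]_nx) (y : stacked R nx nu nz n) : Prop :=
  forall k, Gside y k = Hside p x0 y k.

Definition lagrangian (R : realType) (nx nu nz n : nat)
    (p : mpc_data R nx nu nz) (x0 : 'cV[R]_nx)
    (f : stacked R nx nu nz n -> R) (l : multipliers R nx nz n)
    (y : stacked R nx nu nz n) : R :=
  f y + \sum_k dotv (l k) (Gside y k - Hside p x0 y k).

Definition dual_coef0 (R : realType) (nx nu nz n : nat)
    (p : mpc_data R nx nu nz) (l : multipliers R nx nz n) :
    'cV[R]_(nu + nz) :=
  (H0mat p)^T *m l ord0.

(* [G_k^T lambda_(k-1) - H_k^T lambda_k] for [k = i + 1] *)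
Definition dual_coef (R : realType) (nx nu nz n : nat)
    (p : mpc_data R nx nu nz) (l : multipliers R nx nz n) (i : 'I_n) :
    'cV[R]_(nx + (nu + nz)) :=
  (Gmat R nx nu nz)^T *m l (widen_ord (leqnSn n) i)
  - (Hmat p)^T *m l (lift ord0 i).

Definition dual_coefN (R : realType) (nx nz n : nat)
    (l : multipliers R nx nz n) : 'cV[R]_nx :=
  (GNmat R nx nz)^T *m l ord_max.

Definition Fconj (R : realType) (nx nu nz n : nat) (p : mpc_data R nx nu nz)
    (l : multipliers R nx nz n) : \bar R :=
  ereal_sup [set (- Fcost p y - dotv (dual_coef0 p l) y.1.1
                  + \sum_i dotv (dual_coef p l i) (y.1.2 i)
                  + dotv (l ord_max) (GNmat R nx nz *m y.2))%:E
            | y in [set: stacked R nx nu nz n]].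

(* The factor by which the initial guesses are multiplied before the loop. *)
Definition rescale_factor (R : realType) (nx nu nz n : nat)
    (p : mpc_data R nx nu nz) (gamma : R) (x0 : 'cV[R]_nx)
    (y1 : stacked R nx nu nz n) (l1 : multipliers R nx nz n) : R :=
  let f1 := ((Fcost p y1)%:E + Fconj p l1)%E in
  let b := gamma ^+ 2 * qform (costQ p) x0 in
  if (b%:E <= f1)%E && (f1 != 0%E) then Num.sqrt (b / fine f1) else 1.

Definition decoupled_step (R : realType) (nx nu nz n : nat)
    (p : mpc_data R nx nu nz) (x0 : 'cV[R]_nx)
    (y : stacked R nx nu nz n) (l : multipliers R nx nz n)
    (xi : stacked R nx nu nz n) : Prop :=
  [/\ is_argmin (cstrY0 p x0)
        (fun w => Phi0 p w - dotv (dual_coef0 p l) w + Phi0 p (w - y.1.1))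
        xi.1.1,
      forall i, is_argmin (cstrY p)
        (fun w => Phi p w + dotv (dual_coef p l i) w + Phi p (w - y.1.2 i))
        (xi.1.2 i)
    & is_argmin (cstrYN p)
        (fun w => PhiN p w + dotv (dual_coefN l) w + PhiN p (w - y.2))
        xi.2].

(* [y'] solves the equality-constrained problem and [delta] is a vector of
   Lagrange multipliers for it: [y'] also minimizes the Lagrangian over all
   stacked vectors (the problem being convex). *)
Definition consensus_step (R : realType) (nx nu nz n : nat)
    (p : mpc_data R nx nu nz) (x0 : 'cV[R]_nx)
    (y xi y' : stacked R nx nu nz n) (delta : multipliers R nx nz n) : Prop :=
  let obj := fun v : stacked R nx nu nz n => Fcost p (v - 2%:R *: xi + y) in
  is_argmin (coupled p x0) obj y' /\
  is_argmin setT (lagrangian p x0 obj delta) y'.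

(* [y m], [l m], [xi m] are the iterates with the 1-based index [m]; entries at
   other indices are irrelevant. *)
Definition algorithm_run (R : realType) (nx nu nz n : nat)
    (p : mpc_data R nx nu nz) (gamma : R) (mbar : nat) (x0 : 'cV[R]_nx)
    (y1 : stacked R nx nu nz n) (l1 : multipliers R nx nz n)
    (y : nat -> stacked R nx nu nz n) (l : nat -> multipliers R nx nz n)
    (xi : nat -> stacked R nx nu nz n) : Prop :=
  [/\ y 1%N = rescale_factor p gamma x0 y1 l1 *: y1,
      l 1%N = rescale_factor p gamma x0 y1 l1 *: l1
    & forall m, (1 <= m <= mbar)%N ->
        decoupled_step p x0 (y m) (l m) (xi m) /\
        exists delta, consensus_step p x0 (y m) (xi m) (y m.+1) delta /\
                      l m.+1 = l m + delta].

(* [y_(j+1)] for [j <= n], with [y_N] zero-padded to the size of the middle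
   blocks. *)
Definition padded_block (R : realType) (nx nu nz n : nat)
    (y : stacked R nx nu nz n) (j : nat) : 'cV[R]_(nx + (nu + nz)) :=
  if (insub j : option 'I_n) is Some i then y.1.2 i else col_mx y.2 0.

Definition shift_stacked (R : realType) (nx nu nz n : nat)
    (y : stacked R nx nu nz n) : stacked R nx nu nz n :=
  (dsubmx (padded_block y 0), [ffun i : 'I_n => padded_block y i.+1], 0).

Definition shift_multipliers (R : realType) (nx nz n : nat)
    (l : multipliers R nx nz n) : multipliers R nx nz n :=
  [ffun k : 'I_n.+1 => oapp l 0 (insub k.+1 : option 'I_n.+1)].

(* One sampling period: from the measurement [x0] and the guesses [(y1, l1)] to
   the next measurement [x0'] and the next guesses [(y1', l1')]. *)
Definition sampling_step (R : realType) (nx nu nz n : nat)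
    (p : mpc_data R nx nu nz) (gamma : R) (mbar : nat)
    (x0 : 'cV[R]_nx) (y1 : stacked R nx nu nz n) (l1 : multipliers R nx nz n)
    (x0' : 'cV[R]_nx) (y1' : stacked R nx nu nz n)
    (l1' : multipliers R nx nz n) : Prop :=
  exists (y : nat -> stacked R nx nu nz n) (l : nat -> multipliers R nx nz n)
         (xi : nat -> stacked R nx nu nz n),
    [/\ algorithm_run p gamma mbar x0 y1 l1 y l xi,
        x0' = dynA p *m x0 + row_mx (dynB p) (dynC p) *m (xi mbar).1.1,
        y1' = shift_stacked (y mbar)
      & l1' = shift_multipliers (l mbar)].

(* Main.v *)
(* The first component of [xi_0] lies in [Y_0], so the next state lies in [X],
   provided that the iterates exist.  The decoupled subproblems minimize
   positive definite quadratics over nonempty polyhedra (control invariance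
   makes [Y_0] nonempty), and existence of a minimizer follows by induction on
   the number of half-spaces.  The coupled subproblem is feasible because
   invertibility of [E] lets one simulate the dynamics forward; its multipliers
   come from factoring the gradient at the minimizer through the constraint
   map.  Finally, iterating control invariance gives a feasible trajectory from
   every point of [X]. *)
Require Import Defs.
From HB Require Import structures.
From mathcomp Require Import all_boot all_order all_algebra.
From mathcomp Require Import boolp classical_sets reals constructive_ereal ereal.
From mathcomp Require Import ring lra.

Set Implicit Arguments.
Unset Strict Implicit.
Unset Printing Implicit Defensive.

Import Order.TTheory GRing.Theory Num.Theory.
Local Open Scope classical_set_scope.
Local Open Scope ring_scope.

(** * Linear functionals given as plain functions *)

Section ScalarFunctions.
Context (R : realType) (V : lmodType R).
Implicit Types (a : V -> R) (u v : V) (t : R).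

Lemma scalar0 a : scalar a -> a 0 = 0.
Proof. by move=> ha; have := ha (-1) 0 0; rewrite scaler0 addr0 mulN1r addNr. Qed.

Lemma scalarD a u v : scalar a -> a (u + v) = a u + a v.
Proof. by move=> ha; have := ha 1 u v; rewrite scale1r mul1r. Qed.

Lemma scalarZ a t u : scalar a -> a (t *: u) = t * a u.
Proof. by move=> ha; rewrite -[t *: u]addr0 ha scalar0 // addr0. Qed.

Lemma scalarN a u : scalar a -> a (- u) = - a u.
Proof. by move=> ha; rewrite -scaleN1r scalarZ // mulN1r. Qed.

Lemma scalarB a u v : scalar a -> a (u - v) = a u - a v.
Proof. by move=> ha; rewrite scalarD // scalarN. Qed.

(** Passage to the bundled structure, so that [linfun], kernels and [linear_sum] become
    available. *)
Lemma linear_scalar a : scalar a -> exists L : {linear V -> R^o}, L =1 a.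
Proof.
move=> ha; pose aM := GRing.isLinear.Build R V R^o _ a ha.
pose aL : {linear V -> R^o} := HB.pack a aM.
by exists aL.
Qed.

End ScalarFunctions.

(** * Positive definite quadratic polynomials: minimizers under linear constraints, and
    multipliers *)

Section QuadraticFunctions.
Context (R : realType).

(* [q] is the homogeneous quadratic part of the polynomial [f]; the bilinear
   form [B] need not be symmetric. *)
Definition quadratic_part (V : lmodType R) (f q : V -> R) : Prop :=
  exists (B : V -> V -> R) (c : V -> R) (k : R),
    [/\ forall v, scalar (B v), forall v, scalar (B^~ v), scalar c,
        forall v, q v = B v v & forall v, f v = q v + c v + k].

Definition posdef (V : lmodType R) (q : V -> R) : Prop :=
  forall v, v != 0 -> 0 < q v.

Lemma quadratic_part_qform m (M : 'M[R]_m) :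
  quadratic_part (qform M) (qform M).
Proof.
exists (fun u v => (u^T *m M *m v) 0 0), (fun=> 0), 0; split=> //.
- by move=> v a x y; rewrite mulmxDr -scalemxAr !mxE.
- by move=> v a x y; rewrite linearP /= !mulmxDl -!scalemxAl !mxE.
- by move=> a x y; rewrite mulr0 addr0.
- by move=> v; rewrite !addr0.
Qed.

Lemma quadratic_part_scalar (V : lmodType R) (a : V -> R) :
  scalar a -> quadratic_part a (fun=> 0).
Proof.
move=> ha; exists (fun _ _ => 0), a, 0; split=> //.
- by move=> v t x y; rewrite mulr0 addr0.
- by move=> v t x y; rewrite mulr0 addr0.
- by move=> v; rewrite add0r addr0.
Qed.

Lemma quadratic_partD (V : lmodType R) (f1 f2 q1 q2 : V -> R) :
  quadratic_part f1 q1 -> quadratic_part f2 q2 ->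
  quadratic_part (fun v => f1 v + f2 v) (fun v => q1 v + q2 v).
Proof.
move=> [B1 [c1 [k1 [l1 r1 s1 e1 f1E]]]] [B2 [c2 [k2 [l2 r2 s2 e2 f2E]]]].
exists (fun u v => B1 u v + B2 u v), (fun v => c1 v + c2 v), (k1 + k2); split.
- by move=> v a x y; rewrite l1 l2; ring.
- by move=> v a x y; rewrite r1 r2; ring.
- by move=> a x y; rewrite s1 s2; ring.
- by move=> v; rewrite e1 e2.
- by move=> v; rewrite f1E f2E; ring.
Qed.

Lemma quadratic_part_sum (V : lmodType R) m (f q : 'I_m -> V -> R) :
  (forall i, quadratic_part (f i) (q i)) ->
  quadratic_part (fun v => \sum_i f i v) (fun v => \sum_i q i v).
Proof.
elim: m f q => [|m IH] f q h.
  have -> : (fun v => \sum_i f i v) = (fun=> 0).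
    by apply/funext => v; rewrite big_ord0.
  have -> : (fun v => \sum_i q i v) = (fun=> 0).
    by apply/funext => v; rewrite big_ord0.
  by apply: quadratic_part_scalar => a x y; rewrite mulr0 addr0.
have -> : (fun v => \sum_i f i v)
    = (fun v => f ord0 v + \sum_i f (lift ord0 i) v).
  by apply/funext => v; rewrite big_ord_recl.
have -> : (fun v => \sum_i q i v)
    = (fun v => q ord0 v + \sum_i q (lift ord0 i) v).
  by apply/funext => v; rewrite big_ord_recl.
by apply: quadratic_partD => //; apply: IH.
Qed.

(** The translation by [t] only changes the linear and constant terms, through the cross terms of
    [B]. With [g] an inclusion this restricts [f] to an affine subspace. *)
Lemma quadratic_part_affine (V W : lmodType R) (g : V -> W) (t : W)
    (f q : W -> R) :
  linear g -> quadratic_part f q ->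
  quadratic_part (fun v => f (g v + t)) (fun v => q (g v)).
Proof.
move=> hg [B [c [k [l r s e fE]]]].
exists (fun u v => B (g u) (g v)),
  (fun v => B (g v) t + B t (g v) + c (g v)), (B t t + c t + k); split.
- by move=> v a x y; rewrite hg l.
- by move=> v a x y; rewrite hg r.
- by move=> a x y; rewrite hg s l r; ring.
- by move=> v; rewrite e.
- move=> v; rewrite fE !e.
  rewrite (scalarD _ _ (r _)) !(scalarD _ _ (l _)) (scalarD _ _ s); ring.
Qed.

(** Exact Taylor expansion: [g] is the gradient at [v], and the remainder [q] does not depend on
    [v]. *)
Lemma quadratic_expansion (V : lmodType R) (f q : V -> R) :
  quadratic_part f q -> forall v, exists2 g : V -> R,
    scalar g & forall d, f (v + d) = f v + g d + q d.
Proof.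
move=> [B [c [k [l r s e fE]]]] v; exists (fun d => B v d + B d v + c d).
  by move=> a x y; rewrite l r s; ring.
move=> d; rewrite !fE !e.
rewrite (scalarD _ _ (r _)) !(scalarD _ _ (l _)) (scalarD _ _ s); ring.
Qed.

Lemma quadratic_partZ (V : lmodType R) (f q : V -> R) :
  quadratic_part f q -> forall t v, q (t *: v) = t ^+ 2 * q v.
Proof.
move=> [B [c [k [l r s e fE]]]] t v.
by rewrite !e (scalarZ _ _ (l _)) (scalarZ _ _ (r _)) mulrA.
Qed.

Lemma posdef_ge0 (V : lmodType R) (f q : V -> R) :
  quadratic_part f q -> posdef q -> forall v, 0 <= q v.
Proof.
move=> hf hq v; have [->|/hq/ltW//] := eqVneq v 0.
by rewrite -(scale0r 0) (quadratic_partZ hf) expr0n mul0r.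
Qed.

(** Convexity along the segment, which reduces to [t ^+ 2 <= t] in the expansion of [f] at [v]. *)
Lemma quadratic_min_segment (V : lmodType R) (f q : V -> R) (v s : V) (t : R) :
  quadratic_part f q -> posdef q -> f v <= f s -> 0 <= t <= 1 ->
  f (v + t *: (s - v)) <= f s.
Proof.
move=> hf hq vs /andP[t0 t1]; have [g gS fE] := quadratic_expansion hf v.
have qge := posdef_ge0 hf hq (s - v).
have es : f s = f v + g (s - v) + q (s - v) by rewrite -fE addrC subrK.
rewrite fE (quadratic_partZ hf) (scalarZ _ _ gS) es.
have : t ^+ 2 * q (s - v) <= t * q (s - v).
  by apply: ler_wpM2r => //; rewrite expr2 ler_piMr.
nra.
Qed.

(* The gradient map of [q] is an injective linear map from [V] to its dual,
   hence onto: some point has gradient [- c]. *)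
Lemma quadratic_has_min (V : vectType R) (f q : V -> R) :
  quadratic_part f q -> posdef q -> exists v, is_argmin setT f v.
Proof.
move=> hf hq; have [B [c [k [l r s e fE]]]] := hf.
(* Both orders of the arguments appear because [B] may fail to be symmetric. *)
pose T (v : V) : 'Hom(V, R^o) := linfun (fun w => B v w + B w v : R^o).
have TE v w : T v w = B v w + B w v.
  have [|L LE] := @linear_scalar R V (fun w => B v w + B w v).
    by move=> a x y; rewrite l r; ring.
  by rewrite /T -(funext LE) lfunE.
have Tlin : linear T.
  move=> a x y; apply/lfunP => w.
  by rewrite add_lfunE scale_lfunE !TE r l /GRing.scale /=; ring.
pose TM := GRing.isLinear.Build R V 'Hom(V, R^o) _ T Tlin.
pose TL : {linear V -> 'Hom(V, R^o)} := HB.pack T TM.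
pose Th := linfun TL.
have ker0 : lker Th == 0%VS.
  rewrite -subv0; apply/subvP => v; rewrite memv_ker lfunE /= => /eqP Tv.
  rewrite memv0; apply/negPn/negP => /hq; rewrite e.
  (* [T v v] is twice [q v], so a nonzero kernel vector would contradict definiteness. *)
  have : T v v = 0 by rewrite Tv lfunE.
  by rewrite TE; lra.
have img : limg Th = fullv.
  apply/eqP; rewrite eqEdim subvf limg_dim_eq ?(eqP ker0) ?capv0 //=.
  by rewrite !dimvf /dim /= muln1.
have [C CE] := linear_scalar s.
have : - linfun C \in limg Th by rewrite img memvf.
case/memv_imgP => v _ vE; exists v; split=> // w _.
have grad d : B v d + B d v + c d = 0.
  have : (- linfun C) d = T v d by rewrite vE lfunE.
  by rewrite opp_lfunE lfunE /= CE TE => <-; rewrite addNr.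
(* With the gradient zero, [f (v + d)] equals [f v + q d]. *)
suff min_d d : f v <= f (v + d) by rewrite -(subrK v w) addrC.
have := grad d; have := posdef_ge0 hf hq d; rewrite !fE !e.
rewrite (scalarD _ _ (r _)) !(scalarD _ _ (l _)) (scalarD _ _ s).
move: (B v v) (B v d) (B d v) (B d d) (c v) (c d) => {grad}; clear -R.
by move=> *; lra.
Qed.

Lemma scalar_le_segment (V : lmodType R) (a : V -> R) (b t : R) (v s : V) :
  scalar a -> a v <= b -> a s <= b -> 0 <= t <= 1 ->
  a (v + t *: (s - v)) <= b.
Proof.
move=> ha hv hs /andP[t0 t1].
rewrite (scalarD _ _ ha) (scalarZ _ _ ha) (scalarB _ _ ha); nra.
Qed.

Lemma scalar_crossing (V : lmodType R) (a : V -> R) (b : R) (v s : V) :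
  scalar a -> b < a v -> a s <= b ->
  exists2 t, 0 <= t <= 1 & a (v + t *: (s - v)) = b.
Proof.
move=> ha hv hs; exists ((a v - b) / (a v - a s)).
  by rewrite divr_ge0 ?ler_pdivrMr; lra.
rewrite (scalarD _ _ ha) (scalarZ _ _ ha) (scalarB _ _ ha).
by field; lra.
Qed.

(* If the minimizer without the first constraint violates it, then a minimizer
   lies on the bounding hyperplane of that constraint. *)
Lemma quadratic_min_halfspaces m : forall (V : vectType R) (f q : V -> R)
    (a : 'I_m -> V -> R) (b : 'I_m -> R),
  quadratic_part f q -> posdef q -> (forall i, scalar (a i)) ->
  (exists v, forall i, a i v <= b i) ->
  exists v, is_argmin [set v | forall i, a i v <= b i] f v.
Proof.
elim: m => [|m IH] V f q a b hf hq ha [s0 hs0].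
  have [v [_ vmin]] := quadratic_has_min hf hq.
  by exists v; split=> [[]|w _]; [|apply: vmin].
pose a' i := a (lift ord0 i); pose b' i := b (lift ord0 i).
have consP v : a ord0 v <= b ord0 -> (forall i, a' i v <= b' i) ->
    forall i, a i v <= b i.
  by move=> h0 h1 i; case: (unliftP ord0 i) => [j ->|->//]; apply: h1.
have [||v [v' vmin]] := IH V f q a' b' hf hq; first by move=> i; apply: ha.
  by exists s0 => i; apply: hs0.
have [av|av] := leP (a ord0 v) (b ord0).
  exists v; split=> [|w hw]; first exact: consP.
  by apply: vmin => i; apply: hw.
(* The segment from [v] to a feasible [s] meets the hyperplane, and by convexity [f] is there at
   most [f s], since [v] minimizes under the weaker constraints [a']. *)
have cross s : (forall i, a i s <= b i) ->
    exists t, [/\ a ord0 t = b ord0, forall i, a' i t <= b' i & f t <= f s].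
  move=> hs; have [t t01 tE] := scalar_crossing (ha ord0) av (hs ord0).
  exists (v + t *: (s - v)); split=> // [i|].
    exact: (scalar_le_segment (ha _) (v' i) (hs _)).
  by apply: quadratic_min_segment hf hq _ t01; apply: vmin => i; apply: hs.
have [t [t0 t' _]] := cross s0 hs0.
have [L LE] := linear_scalar (ha ord0).
pose K := lker (linfun L).
have KE x : (x \in K) = (a ord0 x == 0) by rewrite memv_ker lfunE /= LE.
(* The hyperplane is [t + K], and [K] is again a vector space: this is why the induction ranges over
   all [V]. The remaining constraints have their bounds shifted by [a' i t]. *)
have [||||k [k' kmin]] := IH (subvs_of K)
    (fun k => f (vsval k + t)) (fun k => q (vsval k))
    (fun i k => a' i (vsval k)) (fun i => b' i - a' i t).
- by apply: quadratic_part_affine hf; apply: linearP.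
- move=> k k0; apply: hq; apply: contra k0 => /eqP k0.
  by apply/eqP/val_inj; rewrite /= k0.
- by move=> i c x y; rewrite linearP; apply: ha.
- by exists 0 => i; rewrite linear0 /a' (scalar0 (ha _)) subr_ge0; apply: t'.
have a0k x : a ord0 (vsval (K := R) (U := K) x + t) = b ord0.
  have := subvsP x; rewrite KE => /eqP x0.
  by rewrite (scalarD _ _ (ha _)) x0 add0r.
exists (vsval k + t); split=> [|s hs].
  apply: consP; first by rewrite a0k.
  by move=> i; rewrite /a' (scalarD _ _ (ha _)) -lerBrDr; apply: k'.
have [x [x0 x' xs]] := cross s hs; apply: le_trans xs.
have xK : x - t \in K by rewrite KE (scalarB _ _ (ha _)) x0 t0 subrr.
have := kmin (vsproj K (x - t)); rewrite vsprojK // subrK; apply=> i /=.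
by rewrite vsprojK // /a' (scalarB _ _ (ha _)) lerD2r; apply: x'.
Qed.

Lemma quadratic_min_polyhedron m (S : set 'cV[R]_m) (f q : 'cV[R]_m -> R) :
  is_polyhedron S -> quadratic_part f q -> posdef q -> S !=set0 ->
  exists v, is_argmin S f v.
Proof.
move=> [k [M [b ->]]] hf hq [v hv].
apply: (@quadratic_min_halfspaces k 'cV[R]_m f q
  (fun i w => (M *m w) i 0) (fun i => b i 0)) => //.
  by move=> i c x y; rewrite linearP !mxE.
by exists v.
Qed.

Lemma slope_eq0 (a c : R) :
  0 <= c -> (forall t, 0 <= t * a + t ^+ 2 * c) -> a = 0.
Proof.
move=> c0 h; have c1 : 0 < c + 1 by lra.
(* Using [c + 1] instead of [c] keeps the denominator positive; at this point the parabola equals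
   minus a square. *)
have := h (- (a / (c + 1))).
have -> : - (a / (c + 1)) * a + (- (a / (c + 1))) ^+ 2 * c
    = - (a / (c + 1)) ^+ 2.
  by field; lra.
rewrite oppr_ge0 => h0.
have : (a / (c + 1)) ^+ 2 == 0 by rewrite eq_le h0 sqr_ge0.
by rewrite sqrf_eq0 mulf_eq0 invr_eq0 (gt_eqF c1) orbF => /eqP.
Qed.

(* At the constrained minimizer the gradient vanishes on [lker A], so it
   factors through [A]; the multiplier is minus that factor. *)
Lemma quadratic_multiplier (V U : vectType R) (A : 'Hom(V, U)) (b : U)
    (f q : V -> R) :
  quadratic_part f q -> posdef q -> (exists v, A v = b) ->
  exists v, is_argmin [set w | A w = b] f v /\
    exists2 mu : U -> R, scalar mu & forall w, f v <= f w + mu (A w - b).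
Proof.
move=> hf hq [t tb].
have [||k [_ kmin]] := @quadratic_has_min (subvs_of (lker A))
    (fun k => f (vsval k + t)) (fun k => q (vsval k)).
- by apply: quadratic_part_affine hf; apply: linearP.
- move=> k k0; apply: hq; apply: contra k0 => /eqP k0.
  by apply/eqP/val_inj; rewrite /= k0.
pose v := vsval k + t.
have kerk x : A (vsval (K := R) (U := lker A) x) = 0.
  by have := subvsP x; rewrite memv_ker => /eqP.
have Av : A v = b by rewrite linearD /= kerk tb add0r.
have vmin w : A w = b -> f v <= f w.
  move=> wb; have wK : w - t \in lker A.
    by rewrite memv_ker linearB /= wb tb subrr.
  by have := kmin (vsproj _ (w - t)) Logic.I; rewrite vsprojK // subrK.
exists v; split; first by split.
have [g gS fE] := quadratic_expansion hf v.
(* Moving from [v] along a kernel direction keeps the constraint, so the slope of [f] there is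
   zero. *)
have gker d : A d = 0 -> g d = 0.
  move=> Ad; apply: (slope_eq0 (posdef_ge0 hf hq d)) => e.
  have := vmin (v + e *: d).
  rewrite linearD linearZ /= Ad scaler0 addr0 => /(_ Av).
  by rewrite fE (quadratic_partZ hf) (scalarZ _ _ gS) -addrA lerDl.
(* [A^-1] is only a right inverse on the image of [A]: applied to [A (w - v)] it returns [w - v] up
   to a kernel vector, which [g] kills. What remains of the Lagrangian is [f v + q (w - v)]. *)
exists (fun u => - g ((A^-1)%VF u)).
  by move=> c x y; rewrite linearP /= gS; ring.
move=> w; rewrite -Av -linearB /=.
have -> : g ((A^-1)%VF (A (w - v))) = g (w - v).
  apply/eqP; rewrite -subr_eq0 -(scalarB _ _ gS); apply/eqP/gker.
  by rewrite linearB /= limg_lfunVK ?subrr // memv_img ?memvf.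
have -> : f w = f v + g (w - v) + q (w - v) by rewrite -fE addrC subrK.
by rewrite addrAC addrK lerDl; apply: posdef_ge0 hf hq _.
Qed.

End QuadraticFunctions.

(** * Definite forms on product spaces, proximal problems, and functionals in coordinates *)

Section DefiniteQuadraticForms.
Context (R : realType).

(** Being its own quadratic part makes [q] homogeneous, without linear or constant term. *)
Definition posdef_quadratic (V : lmodType R) (q : V -> R) : Prop :=
  quadratic_part q q /\ posdef q.

Lemma quadratic_part_linear (V W : lmodType R) (g : V -> W) (f q : W -> R) :
  linear g -> quadratic_part f q ->
  quadratic_part (fun v => f (g v)) (fun v => q (g v)).
Proof.
move=> hg hf; have -> : (fun v => f (g v)) = (fun v => f (g v + 0)).
  by apply/funext => v; rewrite addr0.
exact: quadratic_part_affine.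
Qed.

Lemma posdef_quadratic_ge0 (V : lmodType R) (q : V -> R) :
  posdef_quadratic q -> forall v, 0 <= q v.
Proof. by case=> qq q_gt0; apply: posdef_ge0 qq q_gt0. Qed.

Lemma posdef_quadratic_qform m (M : 'M[R]_m) :
  sym_posdef M -> posdef_quadratic (qform M).
Proof. by case=> _ M_gt0; split=> //; apply: quadratic_part_qform. Qed.

(** A nonzero [v] has a nonzero component under [g1] or [g2], and that term is positive. With
    projections for [g1] and [g2] this assembles the costs block by block. *)
Lemma posdef_quadraticD (V W1 W2 : lmodType R) (g1 : V -> W1) (g2 : V -> W2)
    (q1 : W1 -> R) (q2 : W2 -> R) :
  linear g1 -> linear g2 -> (forall v, g1 v = 0 -> g2 v = 0 -> v = 0) ->
  posdef_quadratic q1 -> posdef_quadratic q2 ->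
  posdef_quadratic (fun v => q1 (g1 v) + q2 (g2 v)).
Proof.
move=> lin1 lin2 inj h1 h2; split.
  by apply: quadratic_partD; apply: quadratic_part_linear => //;
    [case: h1|case: h2].
move=> v v0; have [g10|g10] := eqVneq (g1 v) 0; last first.
  by apply: ltr_wpDr; [apply: posdef_quadratic_ge0|apply: h1.2].
apply: ltr_wpDl; first exact: posdef_quadratic_ge0.
by apply: h2.2; apply: contra v0 => /eqP g20; rewrite (inj v).
Qed.

Lemma posdef_quadratic_sum (V : lmodType R) n (q : V -> R) :
  posdef_quadratic q ->
  posdef_quadratic (fun y : {ffun 'I_n -> V} => \sum_i q (y i)).
Proof.
move=> hq; split.
  apply: (@quadratic_part_sum R {ffun 'I_n -> V} n
    (fun i y => q (y i)) (fun i y => q (y i))) => i.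
  by apply: quadratic_part_linear hq.1 => a x y; rewrite !ffunE.
move=> y y0; have [i yi] : exists i, y i != 0.
  apply/existsP; apply: contraNT y0 => /existsPn y0.
  by apply/eqP/ffunP => i; rewrite ffunE; apply/eqP/negPn/y0.
rewrite (bigD1 i) //=; apply: ltr_wpDr; last exact: hq.2.
by apply: sumr_ge0 => j _; apply: posdef_quadratic_ge0.
Qed.

Lemma dotv_scalar n (c : 'cV[R]_n) : scalar (dotv c).
Proof. by move=> a x y; rewrite /dotv linearP !mxE. Qed.

(** The common form of the three kinds of decoupled subproblems; the quadratic part of the objective
    is twice [q]. *)
Lemma proximal_min n (S : set 'cV[R]_n) (q : 'cV[R]_n -> R) (c y : 'cV[R]_n) :
  is_polyhedron S -> S !=set0 -> posdef_quadratic q ->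
  exists v, is_argmin S (fun w => q w + dotv c w + q (w - y)) v.
Proof.
move=> polS S0 [qq q_gt0].
apply: (@quadratic_min_polyhedron R n S _ (fun w => q w + 0 + q w)) => //.
- apply: quadratic_partD; first apply: quadratic_partD => //.
    by apply: quadratic_part_scalar; apply: dotv_scalar.
  by apply: (quadratic_part_affine (g := id)).
- by move=> v v0; rewrite addr0 addr_gt0 ?q_gt0.
Qed.

(** The coordinates of [l] are the values of [mu] on the standard basis [e]. This turns an abstract
    multiplier functional into vectors. *)
Lemma scalar_multipliersE m n (mu : {ffun 'I_n -> 'cV[R]_m} -> R) :
  scalar mu -> exists l : {ffun 'I_n -> 'cV[R]_m},
    forall u, mu u = \sum_k dotv (l k) (u k).
Proof.
move=> hmu.
pose e k i : {ffun 'I_n -> 'cV[R]_m} :=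
  [ffun k' => (k' == k)%:R *: delta_mx i 0].
exists [ffun k => \col_i mu (e k i)] => u.
have uE : u = \sum_k \sum_i u k i 0 *: e k i.
  apply/ffunP => k; rewrite sum_ffunE (bigD1 k) //= [X in _ + X]big1 => [|j jk].
    rewrite addr0 sum_ffunE; apply/colP => i; rewrite summxE (bigD1 i) //=.
    rewrite big1 => [|j ji]; rewrite !ffunE eqxx scale1r !mxE eqxx ?andbT.
      by rewrite mulr1 addr0.
    by rewrite eq_sym (negPf ji) mulr0.
  rewrite sum_ffunE big1 // => i _.
  by rewrite !ffunE eq_sym (negPf jk) scale0r scaler0.
have [L LE] := linear_scalar hmu.
rewrite -LE {1}uE linear_sum; apply: eq_bigr => k _.
rewrite linear_sum /dotv mxE; apply: eq_bigr => i _.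
by rewrite linearZ /= LE !ffunE !mxE /GRing.scale /= mulrC.
Qed.

End DefiniteQuadraticForms.

(** * Closure properties of polyhedra *)

Section Polyhedra.
Context (R : realType).

Lemma is_polyhedron_affine m n (S : set 'cV[R]_n) (M : 'M[R]_(n, m))
    (t : 'cV[R]_n) :
  is_polyhedron S -> is_polyhedron [set w | S (M *m w + t)].
Proof.
move=> [k [A [b ->]]]; exists k, (A *m M), (b - A *m t).
apply/seteqP; split=> w /= h i; have := h i;
  by rewrite mulmxDr mulmxA !mxE lerBrDr.
Qed.

Lemma is_polyhedronI n (S T : set 'cV[R]_n) :
  is_polyhedron S -> is_polyhedron T -> is_polyhedron (S `&` T).
Proof.
move=> [k [A [b ->]]] [k' [A' [b' ->]]].
exists (k + k')%N, (col_mx A A'), (col_mx b b').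
apply/seteqP; split=> w /= => [[h h'] i|h].
  by rewrite mul_col_mx; case: (split_ordP i) => j ->;
    rewrite ?col_mxEu ?col_mxEd.
split=> i; [have := h (lshift _ i)|have := h (rshift _ i)];
  by rewrite mul_col_mx ?col_mxEu ?col_mxEd.
Qed.

Lemma mul_row_vsubmx m n1 n2 (M1 : 'M[R]_(m, n1)) (M2 : 'M[R]_(m, n2))
    (w : 'cV[R]_(n1 + n2)) :
  row_mx M1 M2 *m w = M1 *m usubmx w + M2 *m dsubmx w.
Proof. by rewrite -{1}[w]vsubmxK mul_row_col. Qed.

Lemma is_polyhedron0 n : is_polyhedron [set w : 'cV[R]_n | 0 = w].
Proof.
exists (n + n)%N, (col_mx 1%:M (- 1%:M)), 0.
apply/seteqP; split=> w /= => [<- i|h].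
  by rewrite mulmx0.
apply/colP => i; rewrite mxE; apply/eqP; rewrite eq_le.
have := h (lshift _ i); have := h (rshift _ i).
rewrite mul_col_mx col_mxEu col_mxEd mulNmx mul1mx !mxE oppr_le0.
by move=> -> ->.
Qed.

End Polyhedra.

(** * Costs, constraint sets and solvability of the decoupled subproblems *)

Section Algorithm.
Context (R : realType) (nx nu nz n : nat) (p : mpc_data R nx nu nz).
Hypotheses (hU : is_polyhedron (cstrU p)) (hX : is_polyhedron (cstrX p)).
Hypotheses (hXN : is_polyhedron (cstrXN p)) (hZ : is_polyhedron (cstrZ p)).
Hypotheses (hU0 : cstrU p 0) (hX0 : cstrX p 0) (hXN0 : cstrXN p 0).
Hypotheses (hZ0 : cstrZ p 0).
Hypotheses (hQ : sym_posdef (costQ p)) (hR : sym_posdef (costR p)).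
Hypotheses (hS : sym_posdef (costS p)) (hP : sym_posdef (costP p)).
Hypothesis hE : algE p \in unitmx.
Hypothesis hinv : control_invariant p (cstrX p).

Lemma posdef_quadratic_Phi0 : posdef_quadratic (Phi0 p).
Proof.
apply: posdef_quadraticD; try exact: posdef_quadratic_qform; try exact: linearP.
by move=> v u0 d0; rewrite -[v]vsubmxK u0 d0 col_mx0.
Qed.

Lemma posdef_quadratic_Phi : posdef_quadratic (Phi p).
Proof.
have -> : Phi p = fun w => qform (costQ p) (usubmx w) + Phi0 p (dsubmx w).
  by apply/funext => w; rewrite /Phi /Phi0 addrA.
apply: posdef_quadraticD; try exact: linearP.
- by move=> v u0 d0; rewrite -[v]vsubmxK u0 d0 col_mx0.
- exact: posdef_quadratic_qform.
- exact: posdef_quadratic_Phi0.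
Qed.

Lemma posdef_quadratic_PhiN : posdef_quadratic (PhiN p).
Proof. exact: posdef_quadratic_qform. Qed.

Lemma posdef_quadratic_Fcost :
  posdef_quadratic (Fcost p : stacked R nx nu nz n -> R).
Proof.
apply: (posdef_quadraticD (g1 := fst) (g2 := snd) (q2 := PhiN p)
  (q1 := fun v : 'cV[R]_(nu + nz) * {ffun 'I_n -> 'cV[R]_(nx + (nu + nz))} =>
           Phi0 p v.1 + \sum_i Phi p (v.2 i))) => //.
- by case=> v w /= -> ->.
- apply: (posdef_quadraticD (g1 := fst) (g2 := snd) (q1 := Phi0 p)
    (q2 := fun v : {ffun 'I_n -> 'cV[R]_(nx + (nu + nz))} =>
             \sum_i Phi p (v i))) => //.
  + by case=> v w /= -> ->.
  + exact: posdef_quadratic_Phi0.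
  + by apply: posdef_quadratic_sum; apply: posdef_quadratic_Phi.
- exact: posdef_quadratic_PhiN.
Qed.

Lemma is_polyhedron_cstrY0 x0 : is_polyhedron (cstrY0 p x0).
Proof.
(* Each constraint becomes an affine preimage of a polyhedron; the condition on [x0] itself is the
   preimage under a constant map. *)
have -> : cstrY0 p x0 =
    [set w | cstrX p (row_mx (dynB p) (dynC p) *m w + dynA p *m x0)]
    `&` ([set w | 0 = row_mx 0 (algE p) *m w + algD p *m x0]
    `&` ([set w | cstrX p (0 *m w + x0)]
    `&` ([set w | cstrU p (row_mx 1%:M 0 *m w + 0)]
    `&` [set w | cstrZ p (row_mx 0 1%:M *m w + 0)]))).
  have stateE w : row_mx (dynB p) (dynC p) *m w + dynA p *m x0
      = next_state p x0 (usubmx w) (dsubmx w).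
    by rewrite mul_row_vsubmx addrC addrA.
  have residE w : row_mx 0 (algE p) *m w + algD p *m x0
      = algD p *m x0 + algE p *m dsubmx w.
    by rewrite mul_row_vsubmx mul0mx add0r addrC.
  apply/seteqP; split=> w; rewrite /cstrY0 /stage_set /= stateE residE
    /alg_constraint !mul_row_vsubmx !mul0mx !mul1mx !addr0 !add0r.
    by case.
  by case=> ? [? [? []]].
do !apply: is_polyhedronI; try exact: is_polyhedron_affine.
exact: (is_polyhedron_affine _ _ (is_polyhedron0 _ _)).
Qed.

Lemma is_polyhedron_cstrY : is_polyhedron (cstrY p).
Proof.
have -> : cstrY p =
    [set w | cstrX p (row_mx (dynA p) (row_mx (dynB p) (dynC p)) *m w + 0)]
    `&` ([set w | 0 = row_mx (algD p) (row_mx 0 (algE p)) *m w + 0]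
    `&` ([set w | cstrX p (row_mx 1%:M 0 *m w + 0)]
    `&` ([set w | cstrU p (row_mx 0 (row_mx 1%:M 0) *m w + 0)]
    `&` [set w | cstrZ p (row_mx 0 (row_mx 0 1%:M) *m w + 0)]))).
  apply/seteqP; split=> w; rewrite /cstrY /stage_set /= /next_state
    /alg_constraint !mul_row_vsubmx !mul0mx !mul1mx !addr0 !add0r addrA.
    by case.
  by case=> ? [? [? []]].
do !apply: is_polyhedronI; try exact: is_polyhedron_affine.
exact: (is_polyhedron_affine _ _ (is_polyhedron0 _ _)).
Qed.

Lemma decoupled_step_exists x0 (y : stacked R nx nu nz n) l :
  cstrX p x0 -> exists xi, decoupled_step p x0 y l xi.
Proof.
move=> x0X.
(* The linear term of the first subproblem carries a minus sign, hence the negated coefficient. *)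
have [|||a ha] := @proximal_min R _ (cstrY0 p x0) (Phi0 p)
    (- dual_coef0 p l) y.1.1.
- exact: is_polyhedron_cstrY0.
- have [_ /(_ x0 x0X) [x' [u [z [x'X uU zZ x'E alg]]]]] := hinv.
  exists (col_mx u z); rewrite /cstrY0 /stage_set /= col_mxKu col_mxKd.
  by split=> //; rewrite -x'E.
- exact: posdef_quadratic_Phi0.
(* For the later stages the state is a variable and the constraints are homogeneous, so the origin
   is feasible. *)
have cstrY_0 : cstrY p !=set0.
  exists 0; rewrite /cstrY /stage_set /= /xpart /upart /zpart !linear0.
  by rewrite /next_state /alg_constraint !mulmx0 !addr0.
have /choice[b hb] i := proximal_min (dual_coef p l i) (y.1.2 i)
  is_polyhedron_cstrY cstrY_0 posdef_quadratic_Phi.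
have [|||c hc] := @proximal_min R _ (cstrYN p) (PhiN p) (dual_coefN l) y.2.
- exact: hXN.
- by exists 0.
- exact: posdef_quadratic_PhiN.
exists (a, [ffun i => b i], c); split=> //= [|i]; last by rewrite ffunE.
have dotN w : dotv (- dual_coef0 p l) w = - dotv (dual_coef0 p l) w.
  by rewrite /dotv linearN mulNmx mxE.
by case: ha => aY amin; split=> // w /amin; rewrite !dotN.
Qed.

(** * The coupling constraints and solvability of the coupled subproblem *)

Lemma Hside_affine x0 (y : stacked R nx nu nz n) k :
  Hside p x0 y k = Hside p 0 y k + Hside p x0 0 k.
Proof.
rewrite /Hside; case: unliftP => [j _|_] /=.
  by rewrite ffunE mulmx0 addr0.
by rewrite mulmx0 add0r /h0vec !mulmx0 col_mx0 addr0.
Qed.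

(* Taking [x0 = 0] drops the constant [h_0] and leaves a linear map. *)
Definition coupling (y : stacked R nx nu nz n) : multipliers R nx nz n :=
  [ffun k => Gside y k - Hside p 0 y k].

Lemma coupling_linear : linear coupling.
Proof.
move=> a x y; apply/ffunP => k; rewrite !ffunE /Gside /Hside.
rewrite /h0vec !mulmx0 col_mx0 !addr0.
have h m1 m2 (G : 'M[R]_(m1, m2)) (u v : 'cV_m2) :
  G *m (a *: u + v) = a *: (G *m u) + G *m v by exact: linearP.
case: unliftP => [i _|_]; case: unliftP => [j _|_] /=; rewrite ?ffunE !h;
  by rewrite scalerBr opprD addrACA.
Qed.

Lemma couplingE x0 (y : stacked R nx nu nz n) k :
  Gside y k - Hside p x0 y k = (coupling y - [ffun k => Hside p x0 0 k]) k.
Proof. by rewrite Hside_affine !ffunE opprD addrA. Qed.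

Lemma coupledE x0 :
  coupled p x0 = [set y : stacked R nx nu nz n |
                   coupling y = [ffun k => Hside p x0 0 k]].
Proof.
apply/seteqP; split=> y /=.
  move=> h; apply/eqP; rewrite -subr_eq0; apply/eqP/ffunP => k.
  by rewrite -couplingE h subrr ffunE.
by move=> h k; apply/eqP; rewrite -subr_eq0 couplingE h subrr ffunE.
Qed.

Lemma coupled_nonempty x0 : exists y : stacked R nx nu nz n, coupled p x0 y.
Proof.
(* The unique solution of the algebraic equation. The sets [cstrX], [cstrU], [cstrZ] do not enter
   [coupled], so simulating with zero input suffices. *)
pose z (x : 'cV[R]_nx) := - (invmx (algE p) *m (algD p *m x)).
pose step x := next_state p x 0 (z x).
pose x k := iter k step x0.
have alg v : algD p *m v + algE p *m z v = 0.
  by rewrite mulmxN mulKVmx // subrr.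
pose y : stacked R nx nu nz n := (col_mx 0 (z x0),
  [ffun i : 'I_n => col_mx (x i.+1) (col_mx 0 (z (x i.+1)))], x n.+1).
exists y => k.
have -> : Gside y k = col_mx (x k.+1) 0.
  rewrite /Gside; case: unliftP => [i ->|->] /=.
    by rewrite ffunE mul_block_col mul1mx !mul0mx !addr0 /bump leqNgt ltn_ord.
  by rewrite mul_col_mx mul1mx mul0mx.
have -> : x k.+1 = step (x k) by [].
rewrite /Hside; case: unliftP => [i ->|->] /=.
  rewrite ffunE mul_block_col !mul_row_col mulmx0 mul0mx !add0r alg.
  by rewrite /step /next_state mulmx0 addr0.
rewrite mul_block_col mul0mx add0r add_col_mx mulmx0 add0r.
rewrite [algE p *m _ + _]addrC alg.
by rewrite /step /next_state mulmx0 addr0 addrC.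
Qed.

Lemma consensus_step_exists x0 (y xi : stacked R nx nu nz n) :
  exists y' delta, consensus_step p x0 y xi y' delta.
Proof.
pose AM := GRing.isLinear.Build R (stacked R nx nu nz n)
  (multipliers R nx nz n) _ coupling coupling_linear.
pose AL : {linear stacked R nx nu nz n -> multipliers R nx nz n} :=
  HB.pack coupling AM.
pose A := linfun AL.
pose b : multipliers R nx nz n := [ffun k => Hside p x0 0 k].
pose obj (v : stacked R nx nu nz n) := Fcost p (v - 2%:R *: xi + y).
have AE v : A v = coupling v by rewrite lfunE.
have [Fq Fpos] := posdef_quadratic_Fcost.
(* In the variable [v] the objective is a translate of [Fcost p]. *)
have objq : quadratic_part obj (Fcost p).
  have -> : obj = fun v => Fcost p (v + (- (2%:R *: xi) + y)).
    by apply/funext => v; rewrite /obj addrA.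
  have idlin : linear (@id (stacked R nx nu nz n)) by [].
  exact: quadratic_part_affine idlin Fq.
have [|v [vmin [mu hmu muv]]] :=
    quadratic_multiplier (A := A) (b := b) objq Fpos.
  by have [v] := coupled_nonempty x0; rewrite coupledE; exists v; rewrite AE.
have [l lE] := scalar_multipliersE hmu.
have lagE w : lagrangian p x0 obj l w = obj w + mu (A w - b).
  rewrite /lagrangian lE AE; congr (_ + _).
  by apply: eq_bigr => k _; rewrite couplingE.
have vb : A v = b by case: vmin.
exists v, l; split; last first.
  (* At the feasible point [v] the multiplier term vanishes, so [muv] is exactly minimality of the
     Lagrangian. *)
  by split=> // w _; rewrite -/obj !lagE vb subrr scalar0 // addr0.
suff -> : coupled p x0 = [set w | A w = b] by [].
by rewrite coupledE; apply/seteqP; split=> w /=; rewrite AE.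
Qed.

(** * One sampling period, and the domain of the MPC value function *)

Lemma sampling_step_exists gamma mbar x0 (y1 : stacked R nx nu nz n) l1 :
  cstrX p x0 ->
  exists x0' y1' l1', sampling_step p gamma mbar x0 y1 l1 x0' y1' l1'.
Proof.
move=> x0X.
(* Here [s] is the pair of current [y] and [l], and [t] collects [xi], the next [y] and [delta]. *)
have stepP (s : stacked R nx nu nz n * multipliers R nx nz n) :
    exists t : stacked R nx nu nz n * stacked R nx nu nz n *
               multipliers R nx nz n,
      decoupled_step p x0 s.1 s.2 t.1.1 /\
      consensus_step p x0 s.1 t.1.1 t.1.2 t.2.
  have [xi hxi] := decoupled_step_exists s.1 s.2 x0X.
  have [y' [delta h]] := consensus_step_exists x0 s.1 xi.
  by exists (xi, y', delta).
have [f hf] := choice stepP.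
pose next s := ((f s).1.2, s.2 + (f s).2).
pose a := rescale_factor p gamma x0 y1 l1.
(* The predecessor accounts for 1-based iterates: [s 1] is the rescaled initial guess. *)
pose s m := iter m.-1 next (a *: y1, a *: l1).
exists (dynA p *m x0
        + row_mx (dynB p) (dynC p) *m (f (s mbar)).1.1.1.1),
  (shift_stacked (s mbar).1), (shift_multipliers (s mbar).2).
exists (fun m => (s m).1), (fun m => (s m).2), (fun m => (f (s m)).1.1).
split=> //; split=> // -[//|m] _; have [h1 h2] := hf (s m.+1).
by split=> //; exists (f (s m.+1)).2.
Qed.

Lemma sampling_step_cstrX gamma mbar x0 (y1 : stacked R nx nu nz n) l1
    x0' y1' l1' :
  (1 <= mbar)%N -> sampling_step p gamma mbar x0 y1 l1 x0' y1' l1' ->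
  cstrX p x0'.
Proof.
move=> mbar1 [y [l [xi [[_ _ run] -> _ _]]]].
(* Since [mbar] is at least 1, [xi mbar] is an actual iterate, and membership of its first block in
   [cstrY0] contains the claim. *)
have [|[[[xX _ _ _ _] _] _ _] _] := run mbar; first by rewrite mbar1 leqnn.
by rewrite mul_row_vsubmx addrA.
Qed.

Lemma mpc_value_lt_pinfty N x0 :
  cstrXN p = cstrX p -> cstrX p x0 -> (mpc_value p N x0 < +oo)%E.
Proof.
move=> hXNX x0X; have [_ inv] := hinv.
have stepP x : exists t : 'cV[R]_nx * 'cV[R]_nu * 'cV[R]_nz, cstrX p x ->
    [/\ cstrX p t.1.1, cstrU p t.1.2, cstrZ p t.2,
        t.1.1 = next_state p x t.1.2 t.2 & alg_constraint p x t.2].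
  (* The default value 0 outside [cstrX p] only makes the choice function total; the trajectory [x]
     below never leaves [cstrX p]. *)
  have [xX|xX] := pselect (cstrX p x); last by exists 0.
  by have [x' [u [z h]]] := inv x xX; exists (x', u, z).
have [f hf] := choice stepP.
pose x k := iter k (fun x => (f x).1.1) x0.
have xX k : cstrX p (x k) by elim: k => //= k /hf[].
apply: (@le_lt_trans _ _
  (mpc_cost p N x (fun k => (f (x k)).1.2) (fun k => (f (x k)).2))%:E).
  apply: ereal_inf_lbound; do 3 eexists; split; last reflexivity.
  by split=> // [k _|]; [have [] := hf _ (xX k)|rewrite hXNX].
exact: ltry.
Qed.

(** A value below [+oo] yields a feasible trajectory; the horizon is positive, so its stage 0
    constrains [x0]. *)
Lemma mpc_value_domain N x0 : (mpc_value p N.+1 x0 < +oo)%E -> cstrX p x0.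
Proof.
move/ereal_inf_lt => [_ [x [u [z [[<- feas _] _]]]] _].
by have [] := feas 0%N isT.
Qed.

End Algorithm.

(** Existence of a sampling step keeps the invariance claim from being vacuous. As the guesses are
    arbitrary, the shifted ones are covered and the claim applies at every sampling time. *)
Theorem proposition1 (R : realType) (nx nu nz n : nat)
    (p : mpc_data R nx nu nz) (gamma : R) (mbar : nat)
    (hgamma : 0 < gamma) (hmbar : (1 <= mbar)%N)
    (hU : is_polyhedron (cstrU p)) (hX : is_polyhedron (cstrX p))
    (hXN : is_polyhedron (cstrXN p)) (hZ : is_polyhedron (cstrZ p))
    (hU0 : cstrU p 0) (hX0 : cstrX p 0) (hXN0 : cstrXN p 0) (hZ0 : cstrZ p 0)
    (hQ : sym_posdef (costQ p)) (hR : sym_posdef (costR p))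
    (hS : sym_posdef (costS p)) (hP : sym_posdef (costP p))
    (hE : algE p \in unitmx)
    (hXNX : cstrXN p = cstrX p)
    (hinv : control_invariant p (cstrX p)) :
  (forall (x0 : 'cV[R]_nx) (y1 : stacked R nx nu nz n)
          (l1 : multipliers R nx nz n),
     cstrX p x0 ->
     (exists x0' y1' l1', sampling_step p gamma mbar x0 y1 l1 x0' y1' l1') /\
     (forall x0' y1' l1',
        sampling_step p gamma mbar x0 y1 l1 x0' y1' l1' -> cstrX p x0'))
  /\ [set x0 | (mpc_value p n.+1 x0 < +oo)%E] = cstrX p.
Proof.
split=> [x0 y1 l1 x0X|].
  split; first exact: sampling_step_exists.
  by move=> x0' y1' l1'; apply: sampling_step_cstrX.
apply/seteqP; split=> x0; first exact: mpc_value_domain.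
exact: mpc_value_lt_pinfty.
Qed.
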